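(* Let $P(s)=\dfrac{s-z}{(s-p_1)(s-p_2)}$ with $z>0$, $\operatorname{Re}(p_1)>0$, $\operatorname{Re}(p_2)>0$, where $p_1,p_2$ are either both real or a complex conjugate pair. Then $$\log_{10}k_M^{PID}\le\log_{10}k_M\le 2\log_{10}k_M^{PID}.$$
   Context: Controllers: $K_{PID}(s)=k_p+k_i/s+k_d s$ with real coefficients (possibly zero). A general LTI controller is any real rational function $K(s)$. Stabilization (unity negative feedback): write the plant as $P=N_P/D_P$ with numerator and denominator polynomials exactly as displayed (no cancellation of common factors is performed) and a controller as $K=N_K/D_K$ with $N_K,D_K$ coprime real polynomials. For $\alpha>0$, $K$ stabilizes $\alpha P$ if $\deg(N_PN_K)\le\deg(D_PD_K)$ and the closed-loop characteristic polynomial $D_PD_K+\alpha N_PN_K$ has degree $\deg(D_PD_K)$ and all its roots in the open left half-plane. Margins: $k_M=\sup\{\mu:\ \exists K \text{ stabilizing } \alpha P \text{ for all }\alpha\in[1,\mu)\}$ over all general LTI controllers $K$, and $k_M^{PID}$ is the same supremum with $K$ restricted to PID controllers; one and the same controller must work for the whole range of $\alpha$. *)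

(* Defs.v *)
From HB Require Import structures.
From mathcomp Require Import all_boot all_order all_algebra.
From mathcomp Require Import all_classical all_reals all_analysis.
From mathcomp Require Import complex.

Set Implicit Arguments.
Unset Strict Implicit.
Unset Printing Implicit Defensive.

Import Order.TTheory GRing.Theory Num.Theory.

Local Open Scope ring_scope.
Local Open Scope complex_scope.

(* A controller is an element of the field of real rational functions.  A
   plant is a pair of polynomials rather than a fraction, because its common
   factors are never cancelled; it has complex coefficients so that it can be
   written with complex poles. *)
Definition controller (R : realType) := {fraction {poly R}}.

Record plant (R : realType) := Plant {
  plant_num : {poly R[i]};
  plant_den : {poly R[i]}
}.

Definition complexify (R : realType) (p : {poly R}) : {poly R[i]} :=
  map_poly (real_complex R) p.

Definition char_poly_cl (R : realType) (P : plant R) (a : R)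
    (NK DK : {poly R}) : {poly R[i]} :=
  plant_den P * complexify DK + a%:C *: (plant_num P * complexify NK).

(* A coprime representation NK / DK is unique up to a nonzero constant, which
   rescales the characteristic polynomial and nothing else, so the existential
   quantifier does not depend on a choice.  Comparing sizes is comparing
   degrees, with the zero polynomial below every other one. *)
Definition stabilizes (R : realType) (K : controller R) (P : plant R) (a : R)
    : Prop :=
  exists NK DK : {poly R},
    [/\ DK != 0, coprimep NK DK & K = tofrac NK / tofrac DK] /\
    [/\ (size (plant_num P * complexify NK)%R <=
           size (plant_den P * complexify DK)%R)%N,
        size (char_poly_cl P a NK DK) = size (plant_den P * complexify DK) &
        forall s : R[i], root (char_poly_cl P a NK DK) s -> complex.Re s < 0].

Definition PID (R : realType) (kp ki kd : R) : controller R :=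
  tofrac kp%:P + tofrac ki%:P / tofrac 'X + tofrac (kd%:P * 'X).

Definition is_PID (R : realType) (K : controller R) : Prop :=
  exists kp ki kd : R, K = PID kp ki kd.

(* The supremum is taken in the extended reals. *)
Definition gain_margin (R : realType) (admissible : controller R -> Prop)
    (P : plant R) : \bar R :=
  ereal_sup [set mu%:E | mu in [set mu : R |
    exists2 K : controller R, admissible K &
      forall a : R, 1 <= a < mu -> stabilizes K P a]]%classic.

Definition kM (R : realType) (P : plant R) : \bar R :=
  gain_margin (fun=> True) P.

Definition kM_PID (R : realType) (P : plant R) : \bar R :=
  gain_margin (@is_PID R) P.

Definition log10e (R : realType) (x : \bar R) : \bar R :=
  (lne x * ((ln (10%:R : R))^-1)%:E)%E.

Definition plant_z_p1_p2 (R : realType) (z : R) (p1 p2 : R[i]) : plant R :=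
  Plant ('X - (z%:C)%:P) (('X - p1%:P) * ('X - p2%:P)).

(* Main.v *)
Require Import Defs.
From mathcomp Require Import all_boot all_order all_algebra.
From mathcomp Require Import all_classical all_reals all_analysis.
From mathcomp Require Import complex.
From mathcomp Require Import polyrcf ring zify.

Set Implicit Arguments.
Unset Strict Implicit.
Unset Printing Implicit Defensive.

Import Order.TTheory GRing.Theory Num.Theory.
Import numFieldNormedType.Exports.

Local Open Scope ring_scope.
Local Open Scope complex_scope.

(** Let [s = p1 + p2], [q = p1 p2], [a = z^2 + q], [b = s z] and
    [rho = max (a/b, b/a)].  Then [k_M <= rho^2] and [k_M^PID >= rho].

    PD controllers give the lower bound: their closed loop is quadratic,
    hence stable as soon as its three coefficients have the same sign (positive
    if [b < a], negative if [a < b]).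

    Upper bound: suppose that [F_c = D + c N] is Hurwitz for all [c] in [1, m],
    and let [(F0, F1, mu)] be [(F_1, F_m, m)] or [(F_m, F_1, 1/m)], so that
    [d(x) = x^2 - s x + q] divides [mu F0 - F1] and [F0 = F1] at [z].  Then [d]
    divides [G = F0 (x^2 + q)^2 - (s^2 / mu) x^2 F1].  At a point of the
    imaginary axis, [G] is a nonnegative combination of [F0] and [F1], so
    [G / F0] avoids the nonpositive reals there, and following its argument
    along the axis shows that [G] has at most two roots to the right.  These are [p1]
    and [p2], so [H = G / d] has no positive root, and it has the sign of [F0]
    on the positive axis.  At [z] this says that
    [(z^2 + q)^2 - (s^2 / mu) z^2] has the sign of [d(z)]; the two choices of
    [mu] give [m < (a/b)^2] if [d(z) > 0] and [m < (b/a)^2] if [d(z) < 0]. *)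

(** * Winding of a product of linear factors along the imaginary axis *)

Section Winding.
Local Open Scope classical_set_scope.
Variable R : realType.
Implicit Types (r : R[i]) (rs : seq R[i]) (w : R).

(** For roots off the axis, this is modulo [pi] the argument of the product of the factors
    [i w - r], chosen continuous in [w]: a factor with negative real part is replaced by its
    opposite. *)
Definition phase rs w : R :=
  \sum_(r <- rs) atan ((w - complex.Im r) / (- complex.Re r)).

Definition rhp : pred R[i] := [pred r | 0 < complex.Re r].

Lemma continuous_phase rs : continuous (phase rs).
Proof.
elim: rs => [|r rs IH] w; rewrite /phase.
  under eq_fun do rewrite big_nil.
  exact: cvg_cst.
under eq_fun do rewrite big_cons.
apply: cvgD; last exact: IH.
apply: (@continuous_comp _ _ _ (fun w => (w - complex.Im r) / - complex.Re r) atan);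
  last exact: continuous_atan.
apply: cvgMl; apply: cvgB; [exact: cvg_id|exact: cvg_cst].
Qed.

Lemma cvgy_affine (c y : R) : 0 < c -> (w - y) / c @[w --> +oo] --> +oo.
Proof.
move=> c0; apply/cvgryPge => A; exists (A * c + y); split; first exact: num_real.
by move=> w /= Aw; rewrite ler_pdivlMr// lerBrDr ltW.
Qed.

Lemma cvgy_atan_affine (x y : R) : x != 0 ->
  atan ((w - y) / (- x)) @[w --> +oo] --> (if 0 < x then - (pi / 2) else pi / 2).
Proof.
case: ltgtP => // x0 _.
  under eq_fun do rewrite invrN mulrN atanN.
  apply: cvgN; apply: (cvg_comp (fun w => (w - y) / x) atan); last exact: cvgy_atan.
  exact: cvgy_affine.
apply: (cvg_comp (fun w => (w - y) / (- x)) atan); last exact: cvgy_atan.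
by apply: cvgy_affine; rewrite oppr_gt0.
Qed.

Lemma cvgy_phase rs : all (fun r => complex.Re r != 0) rs ->
  phase rs w @[w --> +oo] -->
    pi / 2 *+ size rs - pi *+ count rhp rs.
Proof.
elim: rs => [_|r rs IH /= /andP[r0 /IH {}IH]]; rewrite /phase.
  under eq_fun do rewrite big_nil.
  by rewrite /= !mulr0n subr0; exact: cvg_cst.
under eq_fun do rewrite big_cons.
rewrite (_ : _ - _ = (if 0 < complex.Re r then - (pi / 2) else pi / 2) +
   (pi / 2 *+ size rs - pi *+ count rhp rs)); last first.
  rewrite /= mulrS mulrnDr -[rhp r]/(0 < complex.Re r).
  by case: ifP => _; rewrite /= ?mulr1n ?mulr0n; field.
by apply: cvgD => //; exact: cvgy_atan_affine.
Qed.

(** Conjugating the roots reflects the axis, so the behaviour at [-oo] can be read off from the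
    limit at [+oo]. *)
Lemma phase_conj rs w : phase rs (- w) = - phase (map conjc rs) w.
Proof.
rewrite /phase big_map -sumrN; apply: eq_bigr => -[x y] _ /=.
by rewrite -atanN -mulNr opprD opprK.
Qed.

(** The sign [(-1) ^+ (rhp r)] restores the half turn that [atan] loses. Since [cos (atan t)] is
    [1 / sqrt (1 + t^2)], the modulus is [|x| sqrt (1 + t^2)]. *)
Lemma factor_phase r w : complex.Re r != 0 ->
  exists2 k : R, 0 < k & (0 +i* w) - r = (k * (-1) ^+ (rhp r))%:C *
    (cos (atan ((w - complex.Im r) / - complex.Re r)) +i*
     sin (atan ((w - complex.Im r) / - complex.Re r))).
Proof.
case: r => x y /= x0; set t := (w - y) / - x.
have s0 : 0 < Num.sqrt (1 + t ^+ 2).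
  by rewrite sqrtr_gt0 ltr_pwDl// sqr_ge0.
exists (`|x| * Num.sqrt (1 + t ^+ 2)).
  by rewrite mulr_gt0// normr_gt0.
have -> : sin (atan t) = t * cos (atan t).
  rewrite -[X in _ = X * _]atanK /tan mulfVK//.
  by rewrite cos_atan invr_eq0 gt_eqF.
rewrite cos_atan; apply/eqP; rewrite eq_complex /=.
have xs : `|x| * (-1) ^+ (0 < x)%R = - x.
  by case: ltrgt0P x0 => // h _; rewrite ?expr0 ?expr1 ?mulr1 ?mulrN1.
have -> : `|x| * Num.sqrt (1 + t ^+ 2) * (-1) ^+ (0 < x)%R = - x * Num.sqrt (1 + t ^+ 2).
  by rewrite -xs; ring.
have s0' : Num.sqrt (1 + t ^+ 2) != 0 by rewrite gt_eqF.
apply/andP; split; apply/eqP; first by field.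
by rewrite /t in s0' *; field; rewrite x0 s0'.
Qed.

Lemma prod_phase rs w : all (fun r => complex.Re r != 0) rs ->
  exists2 k : R, 0 < k & \prod_(r <- rs) ((0 +i* w) - r) =
    (k * (-1) ^+ count rhp rs)%:C * (cos (phase rs w) +i* sin (phase rs w)).
Proof.
elim: rs => [_|r rs IH /= /andP[r0 /IH[k k0 kE]]].
  exists 1 => //; rewrite /phase !big_nil /= cos0 sin0 mul1r.
  by rewrite mulr1.
have [l l0 lE] := factor_phase w r0.
exists (l * k); first exact: mulr_gt0.
rewrite /phase !big_cons -/(phase rs w) kE lE cosD sinD exprD.
by apply/eqP; rewrite eq_complex /=; apply/andP; split; apply/eqP; ring.
Qed.

Lemma cos_natpi n : cos (pi *+ n) = (-1) ^+ n :> R.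
Proof.
elim: n => [|n IH]; first by rewrite mulr0n cos0.
by rewrite mulrS addrC cosDpi IH exprS mulN1r.
Qed.

Lemma sin_natpi n : sin (pi *+ n) = 0 :> R.
Proof.
elim: n => [|n IH]; first by rewrite mulr0n sin0.
by rewrite mulrS addrC sinDpi IH oppr0.
Qed.

(** The limit at [+oo] is [pi N - pi (N + n + 1)], which lies a full [pi] below the threshold. *)
Lemma phase_lt_near rs N n : size rs = N.*2 -> count rhp rs = (N + n.+1)%N ->
  all (fun r => complex.Re r != 0) rs ->
  exists2 w, 0 < w & phase rs w < - (pi *+ n).
Proof.
move=> sz ct rs0; have := cvgy_phase rs0; rewrite sz ct.
set l := (X in _ --> X).
have lt : l < - (pi *+ n).
  have -> : l = - (pi *+ n) - pi.
    by rewrite /l -mul2n mulrnA -(mulr_natr (pi / 2)) divfK ?pnatr_eq0// mulrnDr mulrS; ring.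
  by rewrite ltrBlDr ltrDl pi_gt0.
move=> /cvgr_lt/(_ _ lt) [M [_ HM]].
exists (Num.max 1 (M + 1)); first by rewrite lt_max ltr01.
by apply: HM; rewrite lt_max ltrDl ltr01 orbT.
Qed.

(* The argument of the product along the imaginary axis is a sum of arctangents
   with total increment [(N - U) * 2 pi], where [U] counts the roots to the
   right.  If [U > N] it must cross an argument at which the product is
   [(-1) ^+ N] times a negative number. *)
Lemma count_rhp_le rs N : size rs = N.*2 ->
  (forall w k, 0 <= k -> \prod_(r <- rs) ((0 +i* w) - r) != - ((-1) ^+ N * k)%:C) ->
  (count rhp rs <= N)%N.
Proof.
move=> sz H; rewrite leqNgt; apply/negP => ltU.
(* The case [k = 0] of [H] says that the product has no zero on the axis. *)
have rs0 : all (fun r => complex.Re r != 0) rs.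
  apply/allP => r rrs; apply/eqP => r0.
  have := H (complex.Im r) 0 (lexx _); rewrite mulr0 oppr0.
  rewrite prodf_seq_eq0 => /hasPn/(_ _ rrs)/=/eqP; apply; apply/eqP.
  by case: (r) r0 => a b /= ->; rewrite eq_complex /= !subrr eqxx.
pose n := (count rhp rs - N).-1.
have ct : count rhp rs = (N + n.+1)%N by rewrite /n prednK ?subn_gt0// subnKC// ltnW.
have [w1 w10 Hw1] := phase_lt_near sz ct rs0.
have [|||w2 w20 Hw2] := @phase_lt_near (map conjc rs) N n.
- by rewrite size_map.
- by rewrite count_map -ct; apply: eq_count => -[].
- by rewrite all_map; apply/allP => -[x y] /(allP rs0).
(* At [- w2] the phase exceeds [pi *+ n], hence also [- (pi *+ n)], so the intermediate value
   theorem yields a crossing. *)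
have {}Hw2 : - (pi *+ n) < phase rs (- w2).
  rewrite phase_conj ltrNl opprK; apply: lt_le_trans Hw2 _.
  by rewrite (@le_trans _ _ 0)// ?oppr_le0 mulrn_wge0// pi_ge0.
have le12 : - w2 <= w1 by rewrite (@le_trans _ _ 0)// ?oppr_le0 ltW.
have [||w _ Pw] := @IVT R (phase rs) (- w2) w1 (- (pi *+ n)) le12.
- exact/continuous_subspaceT/continuous_phase.
- by rewrite ge_min le_max !(ltW Hw1) !(ltW Hw2) orbT.
have [k k0 kE] := prod_phase w rs0.
have /eqP := H w k (ltW k0); apply.
rewrite kE Pw cosN sinN cos_natpi sin_natpi oppr0 complexr0 -rmorphM -rmorphN /=.
(* The signs are [(-1) ^+ (N + n + 1)] from the roots to the right and [(-1) ^+ n] from the cosine;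
   together they give [- (-1) ^+ N]. *)
congr (_%:C); rewrite ct exprD exprS.
have nn : (-1) ^+ n * (-1) ^+ n = 1 :> R by rewrite -exprMn mulrNN mul1r expr1n.
transitivity (- ((-1) ^+ N * k) * ((-1) ^+ n * (-1) ^+ n)); [ring|by rewrite nn mulr1].
Qed.

End Winding.

(** * Sign of the plant denominator at the zero, from a cone of Hurwitz polynomials *)

Section Separation.
Variable R : realType.
Implicit Types (p F : {poly R}).

Lemma complexify_conj p (s : R[i]) :
  (complexify p).[conjc s] = conjc (complexify p).[s].
Proof.
rewrite -[RHS](horner_map conjc) /complexify -map_poly_comp.
by congr (_.[_]); apply: eq_map_poly => x /=; rewrite oppr0.
Qed.

Lemma root_complexify p (x : R) : root (complexify p) x%:C = root p x.
Proof. exact: fmorph_root. Qed.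

Lemma size_complexify p : size (complexify p) = size p.
Proof. exact: size_map_poly. Qed.

Lemma lead_coef_complexify p : lead_coef (complexify p) = (lead_coef p)%:C.
Proof. exact: lead_coef_map. Qed.

Lemma cevalD p F (x : R[i]) :
  (complexify (p + F)).[x] = (complexify p).[x] + (complexify F).[x].
Proof. by rewrite /complexify rmorphD hornerD. Qed.

Lemma cevalN p (x : R[i]) : (complexify (- p)).[x] = - (complexify p).[x].
Proof. by rewrite /complexify rmorphN hornerN. Qed.

Lemma cevalM p F (x : R[i]) :
  (complexify (p * F)).[x] = (complexify p).[x] * (complexify F).[x].
Proof. by rewrite /complexify rmorphM hornerM. Qed.

Lemma cevalXn p n (x : R[i]) : (complexify (p ^+ n)).[x] = (complexify p).[x] ^+ n.
Proof. by rewrite /complexify rmorphXn horner_exp. Qed.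

Lemma cevalZ (a : R) p (x : R[i]) : (complexify (a *: p)).[x] = a%:C * (complexify p).[x].
Proof. by rewrite /complexify map_polyZ hornerZ. Qed.

Lemma cevalX (x : R[i]) : (complexify 'X).[x] = x.
Proof. by rewrite /complexify map_polyX hornerX. Qed.

Lemma cevalC (a : R) (x : R[i]) : (complexify a%:P).[x] = a%:C.
Proof. by rewrite /complexify map_polyC hornerC. Qed.

Definition cevalE := (cevalD, cevalN, cevalM, cevalXn, cevalZ, cevalX, cevalC).

Definition hurwitz p := forall s : R[i], 0 <= complex.Re s -> ~~ root (complexify p) s.

(** There is no root on [[z, +oo[], so the sign at [z] is already the sign at infinity. *)
Lemma hurwitz_sg p (z : R) : hurwitz p -> 0 <= z -> Num.sg p.[z] = Num.sg (lead_coef p).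
Proof.
move=> hp z0; apply: (@sgp_pinftyP _ z); last by rewrite in_itv /= lexx.
move=> y; rewrite in_itv /= andbT => zy; rewrite -root_complexify.
by apply: hp; rewrite /= (le_trans z0).
Qed.

Lemma prod_oppB (x : R[i]) (rs : seq R[i]) :
  \prod_(r <- rs) (- x - r) = (-1) ^+ size rs * \prod_(r <- rs) (x - - r).
Proof.
elim: rs => [|r rs IH]; first by rewrite !big_nil mulr1.
by rewrite !big_cons IH exprS opprK -opprD mulN1r !mulNr mulrCA.
Qed.

Definition quad (s q : R) : {poly R} := 'X^2 - s *: 'X + q%:P.

Lemma size_quad (s q : R) : size (quad s q) = 3%N.
Proof.
rewrite /quad -addrA size_polyDl size_polyXn// (leq_ltn_trans (size_polyD _ _))//.
rewrite gtn_max size_polyN (leq_ltn_trans (size_scale_leq _ _)) ?size_polyX//.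
by rewrite (leq_ltn_trans (size_polyC_leq1 _)).
Qed.

Lemma complexify_prod_roots p : exists rs : seq R[i],
  complexify p = (lead_coef p)%:C *: \prod_(r <- rs) ('X - r%:P).
Proof.
have [rs pE] := closed_field_poly_normal (complexify p : {poly (R[i] : closedFieldType)}).
by exists rs; rewrite -lead_coef_complexify.
Qed.

Section Key.
Variables (F0 F1 E : {poly R}) (s q m : R) (p1 p2 : R[i]).
Hypothesis quadE : complexify (quad s q) = ('X - p1%:P) * ('X - p2%:P).
Hypotheses (p1_gt0 : 0 < complex.Re p1) (p2_gt0 : 0 < complex.Re p2).
Hypotheses (s_gt0 : 0 < s) (q_gt0 : 0 < q) (m_gt0 : 0 < m).
Hypothesis sizeF : (size F1 <= size F0)%N.
Hypothesis cone : forall u v, 0 <= u -> 0 <= v -> 0 < u + v -> hurwitz (u *: F0 + v *: F1).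
Hypothesis divF : m *: F0 - F1 = quad s q * E.

Let c := s ^+ 2 / m.
Let G := F0 * ('X^2 + q%:P) ^+ 2 - c *: ('X^2 * F1).
Let H := F0 * ('X^2 + s *: 'X + q%:P) + c *: ('X^2 * E).

(** Substitute [F1 = m F0 - quad s q * E] in [G]. Since [c m = s^2], the factor of [F0] becomes the
    difference of squares [(x^2 + q)^2 - s^2 x^2 = (x^2 - s x + q) (x^2 + s x + q)]. *)
Let GE : G = quad s q * H.
Proof.
have -> : G = F0 * ('X^2 + q%:P) ^+ 2 - c *: ('X^2 * (m *: F0 - quad s q * E)).
  by rewrite -divF subKr.
have cm : c%:P * m%:P = s%:P ^+ 2 :> {poly R}.
  by rewrite -rmorphM -rmorphXn /= /c divfK// gt_eqF.
rewrite /H /quad -!mul_polyC.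
transitivity (F0 * (('X^2 + q%:P) ^+ 2 - (c%:P * m%:P) * 'X^2) +
   c%:P * ('X^2 * (('X^2 - s%:P * 'X + q%:P) * E))); first by ring.
by rewrite cm; ring.
Qed.

Let F0_neq0 : F0 != 0.
Proof.
apply/eqP => F00; have := @cone 1 0 ler01 (lexx _).
rewrite addr0 F00 scaler0 scale0r addr0 => /(_ ltr01 0 (lexx _)).
by rewrite /complexify rmorph0 root0.
Qed.

Let size_q2 : size (('X^2 + q%:P) ^+ 2 : {poly R}) = 5.
Proof. by rewrite expr2 size_mul -?size_poly_eq0 size_XnaddC. Qed.

Let size_main : size (F0 * ('X^2 + q%:P) ^+ 2) = (size F0).+4.
Proof. by rewrite size_mul// -?size_poly_eq0 size_q2// addnC. Qed.

(** The term in [F1] has degree at least two below the main term, so [G] inherits the leading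
    coefficient of [F0]. *)
Let size_tail : (size (- (c *: ('X^2 * F1))) < (size F0).+4)%N.
Proof.
rewrite size_polyN; apply: leq_ltn_trans (size_scale_leq _ _) _.
have [->|F10] := eqVneq F1 0; first by rewrite mulr0 size_poly0.
by rewrite size_mul ?expf_neq0 ?polyX_eq0// size_polyXn; exact: leqW sizeF.
Qed.

Let sizeG : size G = (size F0).+4.
Proof. by rewrite /G size_polyDl size_main// size_tail. Qed.

Let lead_coefG : lead_coef G = lead_coef F0.
Proof.
rewrite /G lead_coefDl ?size_main ?size_tail// lead_coefM lead_coef_exp.
by rewrite lead_coefXnaddC// expr1n mulr1.
Qed.

Let lead_coef_quad : lead_coef (quad s q) = 1.
Proof.
apply: complexI; rewrite -lead_coef_complexify quadE lead_coefM.
by rewrite !lead_coefXsubC mul1r.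
Qed.

Let H_neq0 : H != 0.
Proof.
apply/eqP => H0; have := sizeG; by rewrite GE H0 mulr0 size_poly0.
Qed.

Let sizeH : size H = (size F0).+2.
Proof.
have := sizeG; rewrite GE size_mul// ?size_quad; first by move=> [].
by rewrite -size_poly_eq0 size_quad.
Qed.

Let lead_coefH : lead_coef H = lead_coef F0.
Proof. by rewrite -lead_coefG GE lead_coefM lead_coef_quad mul1r. Qed.

Let cevalG (x : R[i]) : (complexify G).[x] =
  (complexify F0).[x] * (x ^+ 2 + q%:C) ^+ 2 - c%:C * (x ^+ 2 * (complexify F1).[x]).
Proof. by rewrite /G !cevalE. Qed.

(** On the axis [F0(-x)] is the conjugate of [F0(x)], so the product is [|F0|^2] times [G / F0]. A
    value [- k] would make [((q - w^2)^2 + kap) F0 + c w^2 F1] vanish at [i w], where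
    [k = kap |F0|^2], against [cone]. *)
Let axisG (w k : R) : 0 <= k ->
  (complexify G).[0 +i* w] * (complexify F0).[- (0 +i* w)] != - k%:C.
Proof.
move=> k0; apply/eqP; rewrite cevalG.
have xN : - (0 +i* w) = conjc (0 +i* w).
  by apply/eqP; rewrite eq_complex /= oppr0 !eqxx.
have x2 : (0 +i* w) ^+ 2 = (- w ^+ 2)%:C.
  by apply/eqP; rewrite eq_complex /=; apply/andP; split; apply/eqP; ring.
have Rex : 0 <= complex.Re (0 +i* w) by [].
rewrite xN (complexify_conj F0) x2.
have conex u v : 0 <= u -> 0 <= v -> 0 < u + v ->
   u%:C * (complexify F0).[0 +i* w] + v%:C * (complexify F1).[0 +i* w] != 0.
  by move=> u0 v0 uv0; have := cone u0 v0 uv0 Rex; rewrite rootE !cevalE.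
case: (complexify F0).[_] conex => a b; case: (complexify F1).[_] => a1 b1 conex.
have f0 : 0 < a ^+ 2 + b ^+ 2.
  have := @conex 1 0 ler01 (lexx _); rewrite addr0 => /(_ ltr01).
  rewrite eq_complex /= !(mul1r, mul0r, subr0, addr0) => h.
  rewrite lt_neqAle addr_ge0 ?sqr_ge0// andbT eq_sym paddr_eq0 ?sqr_ge0//.
  by rewrite !expf_eq0.
move=> /eqP; rewrite eq_complex => /andP[/eqP/= e1 /eqP/= e2].
pose v := c * w ^+ 2.
have [kap kap0 kN] : exists2 kap, 0 <= kap & kap * (a ^+ 2 + b ^+ 2) = k.
  by exists (k / (a ^+ 2 + b ^+ 2)); rewrite ?divfK ?gt_eqF// divr_ge0// ltW.
pose u := (q - w ^+ 2) ^+ 2 + kap.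
have c0 : 0 < c by rewrite /c divr_gt0// exprn_gt0.
have v0 : 0 <= v by rewrite mulr_ge0 ?sqr_ge0// ltW.
have u0 : 0 <= u by rewrite addr_ge0 ?sqr_ge0.
(* The two weights cannot vanish together: if [w^2 = q], then [v = c q > 0]. *)
have uv0 : 0 < u + v.
  have [wq|wq] := eqVneq (q - w ^+ 2) 0.
    rewrite ltr_wpDl// /v mulr_gt0//.
    by move/eqP: wq; rewrite subr_eq0 => /eqP <-.
  by rewrite ltr_pwDl// /u ltr_pwDl// exprn_even_gt0.
have /eqP := conex u v u0 v0 uv0; apply.
(* [X + i Y] is the value of the combination. Its product with the conjugate [a - i b] of the
   nonzero [F0(i w)] is zero, hence so is [X + i Y]. *)
set X := u * a + v * a1; set Y := u * b + v * b1.
have eX : X * a + Y * b = 0.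
  transitivity (- k + kap * (a ^+ 2 + b ^+ 2)); last by rewrite kN addNr.
  by rewrite -e1 /X /Y /u /v; ring.
have eY : Y * a - X * b = 0.
  by rewrite /X /Y /u /v -[RHS]oppr0 -e2; ring.
have X0 : X = 0.
  apply/eqP; rewrite -[_ == _]orbF -[X in _ || X](gt_eqF f0) -mulf_eq0; apply/eqP.
  transitivity (a * (X * a + Y * b) - b * (Y * a - X * b)); first by ring.
  by rewrite eX eY !mulr0 subr0.
have Y0 : Y = 0.
  apply/eqP; rewrite -[_ == _]orbF -[X in _ || X](gt_eqF f0) -mulf_eq0; apply/eqP.
  transitivity (b * (X * a + Y * b) + a * (Y * a - X * b)); first by ring.
  by rewrite eX eY !mulr0 addr0.
apply/eqP; rewrite eq_complex /=; apply/andP; split; apply/eqP.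
  by rewrite -[RHS]X0 /X; ring.
by rewrite -[RHS]Y0 /Y; ring.
Qed.

(** Let [n] be the degree of [F0]. The polynomial [G(x) F0(-x)], of degree [2 (n + 2)], stands in
    for [G / F0], and winding allows it at most [n + 2] roots to the right. The opposites of the
    roots of [F0] account for [n] and [p1], [p2] for two more, so [y] would be one too many. *)
Let noroot_H (y : R) : 0 < y -> ~~ root H y.
Proof.
move=> y0; apply/negP => /factor_theorem[Q HE].
have Q0 : Q != 0 by apply: contra_neq H_neq0 => Q0; rewrite HE Q0 mul0r.
have l0 : lead_coef F0 != 0 by rewrite lead_coef_eq0.
have lQ : lead_coef Q = lead_coef F0.
  by rewrite -lead_coefH HE lead_coefM lead_coefXsubC mulr1.
have sQ : size Q = (size F0).+1.
  by have := sizeH; rewrite HE size_Mmonic ?monicXsubC// size_XsubC addn2 => -[].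
have [rs0 E0] := complexify_prod_roots F0; have [rsQ EQ] := complexify_prod_roots Q.
have lC0 : (lead_coef F0)%:C != 0 :> R[i].
  by apply: contra_neq l0 => /complexI.
have n0 : size F0 = (size rs0).+1.
  by rewrite -size_complexify E0 size_scale// size_prod_XsubC.
have nQ : size rsQ = (size rs0).+1.
  by apply: succn_inj; rewrite -n0 -sQ -size_complexify EQ lQ size_scale// size_prod_XsubC.
(* These are the roots of [G(x) F0(-x)], with multiplicity. *)
pose rs := p1 :: p2 :: y%:C :: map -%R rs0 ++ rsQ.
have rhp0 : all (@rhp R) (map -%R rs0).
  rewrite all_map; apply/allP => r rr0 /=.
  have := @cone 1 0 ler01 (lexx _); rewrite addr0 => /(_ ltr01 r).
  rewrite scale1r scale0r addr0 E0 rootZ// root_prod_XsubC rr0 /=.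
  move=> h; have {h} : complex.Re r < 0 by rewrite ltNge; apply/negP => /h.
  by case: (r) => a b; rewrite /rhp /= oppr_gt0.
have : (count (@rhp R) rs <= (size rs0).+2)%N.
  apply: count_rhp_le.
    by rewrite /= size_cat size_map nQ; lia.
  move=> w k k0; apply/eqP => E1.
  have /eqP := axisG w (mulr_ge0 (sqr_ge0 (lead_coef F0)) k0); apply.
  rewrite GE HE 2!cevalM quadE EQ E0 lQ cevalD cevalN cevalX cevalC.
  rewrite hornerM !hornerXsubC !hornerZ !horner_prod.
  under [in X in _ * X]eq_bigr do rewrite hornerXsubC.
  under eq_bigr do rewrite hornerXsubC.
  rewrite prod_oppB.
  move: E1; rewrite /rs !big_cons big_cat big_map /= => E1.
  pose v : R := (-1) ^+ size rs0.
  have vv : v * v = 1 by rewrite /v -exprMn mulrNN mul1r expr1n.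
  have vE : (-1) ^+ size rs0 = v%:C :> R[i] by rewrite /v rmorphXn rmorphN1.
  (* The sign [(-1) ^+ N] with [N = n + 2] equals the sign [(-1) ^+ n] produced by [F0(-x)], so the
     two cancel. *)
  move: E1; rewrite (_ : (-1) ^+ (size rs0).+2 = v); last by rewrite !exprS !mulN1r opprK.
  rewrite vE; clearbody v => E1.
  transitivity ((lead_coef F0 ^+ 2 * v)%:C * - (v * k)%:C).
    by rewrite -E1 !rmorphM /=; ring.
  rewrite mulrN -rmorphM /=; congr (- _%:C).
  transitivity ((v * v) * (lead_coef F0 ^+ 2 * k)); [ring|by rewrite vv mul1r].
have -> : count (@rhp R) rs = ((size rs0).+3 + count (@rhp R) rsQ)%N.
  rewrite /rs /= count_cat.
  by move: rhp0; rewrite all_count size_map => /eqP ->; rewrite /rhp /= p1_gt0 p2_gt0 y0.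
by rewrite ltnNge leq_addr.
Qed.

(** At [z], [G] equals [F0] times the bracket on the right, and also [quad s q * H], where [H] has
    the nonzero sign of [F0]; that sign cancels. *)
Lemma sign_separation (z : R) : 0 < z -> F0.[z] = F1.[z] ->
  Num.sg (quad s q).[z] = Num.sg ((z ^+ 2 + q) ^+ 2 - s ^+ 2 / m * z ^+ 2).
Proof.
move=> z0 Fz.
have hF : hurwitz F0.
  by have := @cone 1 0 ler01 (lexx _); rewrite addr0 scale1r scale0r addr0; apply.
have sH : Num.sg H.[z] = Num.sg F0.[z].
  rewrite (hurwitz_sg hF (ltW z0)) -lead_coefH; apply: (@sgp_pinftyP _ z).
    by move=> y; rewrite in_itv /= andbT => zy; apply/noroot_H/(lt_le_trans z0).
  by rewrite in_itv /= lexx.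
have F0z : Num.sg F0.[z] != 0.
  by rewrite (hurwitz_sg hF (ltW z0)) sgr_eq0 lead_coef_eq0.
apply: (mulIf F0z); rewrite -{1}sH -!sgrM -hornerM -GE /G /c; congr (Num.sg _).
by rewrite hornerD hornerN hornerZ hornerM (hornerM _ F1) horner_exp hornerD hornerXn hornerC -Fz; ring.
Qed.

End Key.
End Separation.

(** [stabilizes] hides a coprime pair for each gain separately; this lets closed loops at different
    gains share one pair. *)
Lemma coprime_frac_unique (F : fieldType) (N D N' D' : {poly F}) :
  D != 0 -> D' != 0 -> coprimep N D -> coprimep N' D' ->
  tofrac N / tofrac D = tofrac N' / tofrac D' ->
  exists2 c, c != 0 & N = c *: N' /\ D = c *: D'.
Proof.
move=> D0 D'0 cND cND' /eqP.
rewrite eqr_div ?tofrac_eq0// -!tofracM tofrac_eq => /eqP E.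
have /eqpf_eq[c c0 DE] : D %= D'.
  rewrite /eqp -(Gauss_dvdpr D' (_ : coprimep D N)) 1?coprimep_sym// E dvdp_mull//=.
  by rewrite -(Gauss_dvdpr D (_ : coprimep D' N')) 1?coprimep_sym// -E dvdp_mull.
exists c => //; split=> //; apply: (mulIf D'0).
by rewrite E DE -scalerAl -scalerAr.
Qed.

(** * Bounds on the two gain margins *)

Section Margin.
Variable R : realType.
Implicit Types (z s q a m mu : R).

Lemma poles_quad (p1 p2 : R[i]) : 0 < complex.Re p1 -> 0 < complex.Re p2 ->
  (complex.Im p1 = 0 /\ complex.Im p2 = 0) \/ p2 = conjc p1 ->
  exists s q, [/\ 0 < s, 0 < q &
    complexify (quad s q) = ('X - p1%:P) * ('X - p2%:P)].
Proof.
move=> p10 p20 h.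
have [s [q [s0 q0 sE qE]]] : exists s q, [/\ 0 < s, 0 < q, s%:C = p1 + p2 & q%:C = p1 * p2].
  case: p1 p2 p10 p20 h => a b [c d] /= a0 c0 [[-> ->]|[-> ->]].
    exists (a + c), (a * c); rewrite addr_gt0// mulr_gt0//; split=> //.
      by apply/eqP; rewrite eq_complex /= addr0 !eqxx.
    by apply/eqP; rewrite eq_complex /= !mulr0 mul0r subr0 addr0 !eqxx.
  exists (a + a), (a ^+ 2 + b ^+ 2); split.
  - exact: addr_gt0.
  - by rewrite ltr_pwDl ?sqr_ge0// exprn_gt0.
  - by apply/eqP; rewrite eq_complex /= subrr !eqxx.
  - by apply/eqP; rewrite eq_complex /=; apply/andP; split; apply/eqP; ring.
exists s, q; split=> //.
rewrite /complexify /quad rmorphD rmorphB /= map_polyZ map_polyXn map_polyX map_polyC /=.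
by rewrite sE qE -mul_polyC polyCD polyCM; ring.
Qed.

(** At [x + i y] the imaginary part is [y (2 A x + B)]. A root with [x >= 0] is therefore real, but
    there the value is at least [C]. *)
Lemma hurwitz_quadratic (A B C : R) : 0 < A -> 0 < B -> 0 < C ->
  hurwitz (A *: 'X^2 + B *: 'X + C%:P).
Proof.
move=> A0 B0 C0 [x y] /= x0; rewrite rootE !cevalE eq_complex /=.
apply/negP => /andP[/eqP e1 /eqP e2].
have y0 : y = 0.
  have : y * (2 * A * x + B) = 0 by rewrite -e2; ring.
  move=> /eqP; rewrite mulf_eq0 => /orP[/eqP//|]; rewrite gt_eqF// ltr_wpDl//.
  by rewrite mulr_ge0// mulr_ge0// ltW.
have : 0 < A * x ^+ 2 + B * x + C.
  by rewrite ltr_wpDl// addr_ge0 ?mulr_ge0 ?sqr_ge0// ltW.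
suff -> : A * x ^+ 2 + B * x + C = 0 by rewrite ltxx.
by rewrite -[RHS]e1 y0; ring.
Qed.

Lemma size_quadratic (A B C : R) : A != 0 -> size (A *: 'X^2 + B *: 'X + C%:P) = 3%N.
Proof.
move=> A0; rewrite -addrA size_polyDl size_scale// size_polyXn//.
rewrite (leq_ltn_trans (size_polyD _ _))//.
rewrite gtn_max (leq_ltn_trans (size_scale_leq _ _)) ?size_polyX//.
by rewrite (leq_ltn_trans (size_polyC_leq1 _)).
Qed.

Section Plant.
Variables (z s q : R) (p1 p2 : R[i]).
Hypotheses (z_gt0 : 0 < z) (s_gt0 : 0 < s) (q_gt0 : 0 < q).
Hypotheses (p1_gt0 : 0 < complex.Re p1) (p2_gt0 : 0 < complex.Re p2).
Hypothesis quadE : complexify (quad s q) = ('X - p1%:P) * ('X - p2%:P).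
Let P := plant_z_p1_p2 z p1 p2.

(** The real form of [char_poly_cl]; it is affine in the gain [a]. *)
Definition clpoly (N D : {poly R}) a : {poly R} :=
  quad s q * D + a *: (('X - z%:P) * N).

Lemma plant_numE : plant_num P = complexify ('X - z%:P).
Proof. by rewrite /= /complexify rmorphB /= map_polyX map_polyC. Qed.

Lemma plant_denE : plant_den P = complexify (quad s q).
Proof. by rewrite quadE. Qed.

Lemma char_poly_clE N D a : char_poly_cl P a N D = complexify (clpoly N D a).
Proof.
rewrite /char_poly_cl plant_numE plant_denE /complexify /clpoly.
by rewrite [RHS]rmorphD /= map_polyZ !rmorphM.
Qed.

(** [A], [B], [C] are the closed-loop coefficients for the coprime pair [(kp + kd x, 1)]. That [A]
    is nonzero also keeps the degree from dropping. *)
Lemma stabilizes_PD kp kd a :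
  let A := 1 + a * kd in let B := - s + a * (kp - z * kd) in let C := q - a * z * kp in
  [/\ 0 < A, 0 < B & 0 < C] \/ [/\ A < 0, B < 0 & C < 0] ->
  stabilizes (PID kp 0 kd) P a.
Proof.
move=> A B C ABC.
have A0 : A != 0 by case: ABC => -[]; [move/gt_eqF->|move/lt_eqF->].
exists (kp%:P + kd%:P * 'X), 1; split; first split.
- exact: oner_neq0.
- exact: coprimep1.
- by rewrite /PID tofrac0 mul0r addr0 tofrac1 divr1 tofracD.
have cE : clpoly (kp%:P + kd%:P * 'X) 1 a = A *: 'X^2 + B *: 'X + C%:P.
  rewrite /clpoly /quad /A /B /C -!mul_polyC !(polyCD, polyCN, polyCM, polyCB); ring.
rewrite char_poly_clE cE plant_numE plant_denE /complexify rmorph1 mulr1.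
rewrite -/(complexify _) !size_complexify size_quad size_quadratic//; split=> //.
  rewrite -rmorphM /= size_map_poly (leq_trans (size_polyMleq _ _))//.
  rewrite size_XsubC /= add1n ltnS (leq_trans (size_polyD _ _))// geq_max.
  rewrite (leq_trans (size_polyC_leq1 _))//=.
  by rewrite mul_polyC (leq_trans (size_scale_leq _ _))// size_polyX.
move=> x; rewrite -/(complexify _) ltNge; apply: contraTN => x0.
case: ABC => -[A1 B1 C1]; first exact: hurwitz_quadratic.
have := @hurwitz_quadratic (- A) (- B) (- C); rewrite !oppr_gt0 => /(_ A1 B1 C1 x x0).
by rewrite !rootE !cevalE !rmorphN /= !mulNr -!opprD oppr_eq0.
Qed.

Lemma stabilizes_clpoly K N D a : D != 0 -> coprimep N D -> K = tofrac N / tofrac D ->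
  stabilizes K P a ->
  size (clpoly N D a) = size (quad s q * D) /\ hurwitz (clpoly N D a).
Proof.
move=> D0 cND KE [N' [D' [[D'0 cND' KE']]]].
rewrite !char_poly_clE plant_denE plant_numE /complexify -!rmorphM /= -!/(complexify _).
rewrite !size_complexify => -[_ sz rt].
have [c c0 [NE DE]] := coprime_frac_unique D'0 D0 cND' cND (etrans (esym KE') KE).
have cE : clpoly N' D' a = c *: clpoly N D a.
  by rewrite /clpoly NE DE -!mul_polyC; ring.
split; first by move: sz; rewrite cE DE -scalerAr !size_scale.
move=> x x0; apply/negP => rx; have := rt x; rewrite cE rootE cevalZ.
by rewrite (rootP rx) mulr0 eqxx ltNge x0 => /(_ isT).
Qed.

Lemma horner_clpoly_zero N D a : (clpoly N D a).[z] = (quad s q).[z] * D.[z].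
Proof.
by rewrite /clpoly hornerD hornerZ !hornerM hornerXsubC subrr mul0r mulr0 addr0.
Qed.

Lemma horner_quad x : (quad s q).[x] = x ^+ 2 - s * x + q.
Proof. by rewrite /quad hornerD hornerD hornerN hornerZ hornerXn hornerX hornerC. Qed.

Lemma robust_stabilizes_bound K m : 1 < m ->
  (forall a, 1 <= a <= m -> stabilizes K P a) ->
  [/\ (quad s q).[z] != 0,
      0 < (quad s q).[z] -> m * (s * z) ^+ 2 < (z ^+ 2 + q) ^+ 2 &
      (quad s q).[z] < 0 -> m * (z ^+ 2 + q) ^+ 2 < (s * z) ^+ 2].
Proof.
move=> m1 st; have m0 : 0 < m := lt_trans ltr01 m1.
have [N [D [[D0 cND KE] _]]] : stabilizes K P 1 by apply: st; rewrite lexx ltW.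
pose F a := clpoly N D a.
have sF a : 1 <= a <= m -> size (F a) = size (quad s q * D).
  by move=> /st /(stabilizes_clpoly D0 cND KE)[].
have hF a : 1 <= a <= m -> hurwitz (F a).
  by move=> /st /(stabilizes_clpoly D0 cND KE)[].
have i1 : (1 : R) <= 1 <= m by rewrite lexx /= ltW.
have im : 1 <= m <= m by rewrite lexx andbT ltW.
(* As [F] is affine in the gain, a nonnegative combination of [F 1] and [F m] is a positive multiple
   of [F] at a weighted mean of [1] and [m]. *)
have cone u v : 0 <= u -> 0 <= v -> 0 < u + v -> hurwitz (u *: F 1 + v *: F m).
  move=> u0 v0 uv0.
  have E : u + v != 0 by rewrite gt_eqF.
  have -> : u *: F 1 + v *: F m = (u + v) *: F ((u + v * m) / (u + v)).
    by rewrite /F /clpoly !scalerDr !scalerA (mulrCA (u + v)) mulfV// !mulr1 !scalerDl addrACA.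
  have ha : hurwitz (F ((u + v * m) / (u + v))).
    apply: hF; rewrite ler_pdivlMr// ler_pdivrMr//; apply/andP; split.
      by rewrite mul1r lerD2l ler_peMr// ltW.
    by rewrite mulrDr (mulrC m v) lerD2r ler_peMl// ltW.
  move=> x x0; have := ha x x0; apply: contraNN.
  rewrite !rootE cevalZ mulf_eq0 => /orP[|//].
  by move=> /eqP/complexI/eqP; rewrite (negPf E).
(* The plant numerator vanishes at [z], so the gain has no effect there. *)
have Fz : (F 1).[z] = (F m).[z] by rewrite /F !horner_clpoly_zero.
have F1z : (F 1).[z] != 0.
  have /= := hF 1 i1 z%:C; rewrite root_complexify; apply; exact: ltW.
split.
- by apply: contra_neq F1z => q0; rewrite /F horner_clpoly_zero q0 mul0r.
- move=> d0.
  have cone' u v : 0 <= u -> 0 <= v -> 0 < u + v -> hurwitz (u *: F m + v *: F 1).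
    by move=> u0 v0 uv0; rewrite addrC; apply: cone => //; rewrite addrC.
  (* The weight [m^-1] equalises the coefficients of the plant numerator, which cancels and leaves a
     multiple of [quad s q]. *)
  have div : m^-1 *: F m - F 1 = quad s q * ((m^-1 - 1) *: D).
    rewrite /F /clpoly scalerDr scalerA mulVf ?gt_eqF// scalerBl !scale1r mulrBr -scalerAr.
    by rewrite opprD addrACA subrr addr0.
  have mI0 : 0 < m^-1 by rewrite invr_gt0.
  have sz : (size (F 1%R) <= size (F m))%N by rewrite !sF.
  have := sign_separation quadE p1_gt0 p2_gt0 s_gt0 q_gt0 mI0 sz cone' div z_gt0 (esym Fz).
  rewrite (gtr0_sg d0) invrK => /esym/eqP; rewrite sgr_cp0 subr_gt0.
  by apply: le_lt_trans; rewrite exprMn mulrCA mulrA.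
- move=> d0.
  have div : m *: F 1 - F m = quad s q * ((m - 1) *: D).
    rewrite /F /clpoly scalerDr scalerA mulr1 scalerBl scale1r mulrBr -scalerAr.
    by rewrite opprD addrACA subrr addr0.
  have sz : (size (F m) <= size (F 1%R))%N by rewrite !sF.
  have := sign_separation quadE p1_gt0 p2_gt0 s_gt0 q_gt0 m0 sz cone div z_gt0 Fz.
  rewrite (ltr0_sg d0) => /esym/eqP.
  rewrite sgr_cp0 subr_lt0 mulrAC ltr_pdivlMr//.
  by rewrite mulrC exprMn.
Qed.

Let a := z ^+ 2 + q.
Let b := s * z.

Let a_gt0 : 0 < a. Proof. by rewrite /a ltr_wpDl ?sqr_ge0. Qed.
Let b_gt0 : 0 < b. Proof. exact: mulr_gt0. Qed.
Let quad_z : (quad s q).[z] = a - b.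
Proof. by rewrite horner_quad /a /b; ring. Qed.

Definition rho : R := Num.max (a / b) (b / a).

Lemma rho_ge1 : 1 <= rho.
Proof.
rewrite /rho le_max ler_pdivlMr// ler_pdivlMr// !mul1r.
by case/orP: (le_total b a) => ->; rewrite ?orbT.
Qed.

(* If [b < a], the first and last closed-loop coefficients vanish at [c = mu] and
   the middle one is positive because [mu * b < a].  If [a < b], [l] is chosen
   above [1] so that the middle coefficient vanishes at [c = mu]. *)
Lemma PID_margin_lt_rho mu : 1 < mu -> mu < rho ->
  exists2 K : controller R, is_PID K & forall c, 1 <= c < mu -> stabilizes K P c.
Proof.
move=> mu1; have mu0 : 0 < mu := lt_trans ltr01 mu1.
have [z0 mu_neq0 a0] : [/\ z != 0, mu != 0 & a != 0] by rewrite !gt_eqF.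
rewrite /rho lt_max => /orP[]; rewrite ltr_pdivlMr// => hmu.
  exists (PID (q / (z * mu)) 0 (- mu^-1)); first by do 3!eexists.
  move=> c /andP[c1 cmu]; have c0 : 0 < c := lt_le_trans ltr01 c1.
  apply: stabilizes_PD; left; split.
  - by rewrite mulrN subr_gt0 ltr_pdivrMr// mul1r.
  - rewrite (_ : _ + _ = c * a / (z * mu) - s); last by rewrite /a; field; rewrite ?z0 ?mu_neq0.
    rewrite subr_gt0 ltr_pdivlMr ?mulr_gt0//.
    apply: lt_le_trans (_ : a <= _); last by rewrite ler_peMl// ltW.
    by move: hmu; rewrite /b; apply: le_lt_trans; rewrite mulrA mulrC.
  - rewrite (_ : _ - _ = q * (mu - c) / mu); last by field; rewrite ?z0 ?mu_neq0.
    by rewrite divr_gt0// mulr_gt0// subr_gt0.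
pose l := b / (a * mu).
have l1 : 1 < l by rewrite /l ltr_pdivlMr ?mulr_gt0// mul1r mulrC.
exists (PID (l * q / z) 0 (- l)); first by do 3!eexists.
move=> c /andP[c1 cmu]; have c0 : 0 < c := lt_le_trans ltr01 c1.
have cl : 1 < c * l by rewrite (lt_le_trans l1)// ler_peMl// ltW// (lt_trans ltr01).
apply: stabilizes_PD; right; split.
- by rewrite mulrN subr_lt0.
- rewrite (_ : _ + _ = c * l * a / z - s); last by rewrite /a; field.
  rewrite (_ : c * l * a / z = s * (c / mu)); last by rewrite /l /b; field; rewrite ?z0 ?mu_neq0 ?a0.
  by rewrite subr_lt0 gtr_pMr// ltr_pdivrMr// mul1r.
- rewrite (_ : _ - _ = q * (1 - c * l)); last by field; rewrite ?z0.
  by rewrite pmulr_rlt0// subr_lt0.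
Qed.

Lemma kM_PID_ge_rho : (rho%:E <= kM_PID P)%E.
Proof.
have ub mu : mu < rho -> (mu%:E <= kM_PID P)%E.
  move=> hmu; apply: ereal_sup_ubound; exists mu => //=.
  have [mu1|mu1] := ltP 1 mu; first exact: PID_margin_lt_rho.
  (* For [mu <= 1] the range of gains is empty and any controller serves. *)
  exists (PID 0 0 0); first by do 3!eexists.
  by move=> c /andP[c1 cmu]; have := lt_le_trans (le_lt_trans c1 cmu) mu1; rewrite ltxx.
move: ub; case: (kM_PID P) => [r|_|/(_ (rho - 1))]; last 2 first.
- by rewrite leey.
- by rewrite ltrBlDr ltrDl ltr01 => /(_ isT).
move=> ub; rewrite lee_fin leNgt; apply/negP => hr.
have := ub ((r + rho) / 2); rewrite lee_fin midf_lt// => /(_ isT).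
by rewrite leNgt midf_lt.
Qed.

(** A robust range beyond [rho ^+ 2] would allow the bound at [m = rho ^+ 2], giving [rho b < a] or
    [rho a < b], against the choice of [rho] as a maximum. *)
Lemma kM_le_rho2 : (kM P <= (rho ^+ 2)%:E)%E.
Proof.
apply: ge_ereal_sup => _ [mu [K _ st] <-]; rewrite lee_fin leNgt; apply/negP => hmu.
have mu1 : 1 < mu by apply: le_lt_trans hmu; rewrite expr_ge1// ?rho_ge1// (le_trans ler01 rho_ge1).
have bound m : 1 < m -> m < mu -> [/\ a - b != 0,
   0 < a - b -> m * b ^+ 2 < a ^+ 2 & a - b < 0 -> m * a ^+ 2 < b ^+ 2].
  move=> m1 hm; rewrite -quad_z; apply: (robust_stabilizes_bound m1 (K := K)) => c /andP[c1 cm].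
  by apply: st; rewrite c1 (le_lt_trans cm).
(* The midpoint of [1] and [mu] serves only to get [a != b], hence [1 < rho], so that [m = rho ^+ 2]
   becomes admissible. *)
have [ab0 _ _] : [/\ a - b != 0, 0 < a - b -> ((1 + mu) / 2) * b ^+ 2 < a ^+ 2 &
   a - b < 0 -> ((1 + mu) / 2) * a ^+ 2 < b ^+ 2].
  by apply: bound; rewrite midf_lt.
have r1 : 1 < rho.
  rewrite /rho lt_max !ltr_pdivlMr// !mul1r.
  by move: ab0; rewrite subr_eq0 neq_lt => /orP[]->; rewrite ?orbT.
have rho0 : 0 < rho := lt_trans ltr01 r1.
have ra0 := mulr_gt0 rho0 a_gt0; have rb0 := mulr_gt0 rho0 b_gt0.
have r2 : 1 < rho ^+ 2 by rewrite expr_gt1// (le_trans ler01 rho_ge1).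
have [_ pos neg] := bound _ r2 hmu.
have [h|h|h] := ltgtP (a - b) 0; last by rewrite h eqxx in ab0.
- have := neg h; rewrite ltNge -exprMn ler_pXn2r ?nnegrE ?(ltW ra0) ?(ltW b_gt0)//.
  by rewrite -ler_pdivrMr// /rho le_max lexx orbT.
- have := pos h; rewrite ltNge -exprMn ler_pXn2r ?nnegrE ?(ltW rb0) ?(ltW a_gt0)//.
  by rewrite -ler_pdivrMr// /rho le_max lexx.
Qed.

End Plant.

Lemma kM_PID_le_kM (P : plant R) : (kM_PID P <= kM P)%E.
Proof.
apply: le_ereal_sup => _ [mu [K _ st] <-].
by exists mu => //; exists K.
Qed.

End Margin.

Theorem corollary4p1 (R : realType) (z : R) (p1 p2 : R[i])
    (z_gt0 : 0 < z)
    (p1_gt0 : 0 < complex.Re p1) (p2_gt0 : 0 < complex.Re p2)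
    (p12 : (complex.Im p1 = 0 /\ complex.Im p2 = 0) \/ p2 = conjc p1) :
  let P := plant_z_p1_p2 z p1 p2 in
  (log10e (kM_PID P) <= log10e (kM P))%E /\
  (log10e (kM P) <= 2%:E * log10e (kM_PID P))%E.
Proof.
move=> P.
have [s [q [s0 q0 sqE]]] := poles_quad p1_gt0 p2_gt0 p12.
have r1 := rho_ge1 z_gt0 s0 q0.
have lo := kM_PID_ge_rho z_gt0 s0 q0 sqE.
have up := kM_le_rho2 z_gt0 s0 q0 p1_gt0 p2_gt0 sqE.
have le := kM_PID_le_kM P.
set r := rho z s q in r1 lo up.
have r_gt0 : 0 < r := lt_le_trans ltr01 r1.
(* Nonnegativity places both margins in the domain on which [lne] is monotone. *)
have X0 : (0 <= kM_PID P)%E by apply: le_trans lo; rewrite lee_fin ltW.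
have Y0 : (0 <= kM P)%E := le_trans X0 le.
have c0 : (0 <= ((ln (10%:R : R))^-1)%:E)%E.
  by rewrite lee_fin invr_ge0 ln_ge0// ler1n.
rewrite /log10e; split.
  by apply: lee_wpmul2r => //; rewrite lee_lne// in_itv /= ?X0 ?Y0 leey.
(* The chain is [log (kM P) <= log (r^2) = 2 log r <= 2 log (kM_PID P)]. *)
apply: (@le_trans _ _ (lne (r ^+ 2)%:E * ((ln (10%:R : R))^-1)%:E)%E).
  by apply: lee_wpmul2r => //; rewrite lee_lne// in_itv /= ?Y0 ?leey// lee_fin sqr_ge0.
rewrite lne_EFin ?exprn_gt0// lnXn// muleA -[ln r *+ 2]mulr_natl EFinM.
apply: lee_wpmul2r => //; apply: lee_wpmul2l; first by rewrite lee_fin.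
by rewrite -lne_EFin// lee_lne// in_itv /= ?X0 ?leey// lee_fin ltW.
Qed.
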